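(* Let $s$ be an indeterminate over $\mathbb{Q}$, let $c=\frac{s^4-6s^2+1}{(1+s^2)^2}$ and $A=2-4c^2\in\mathbb{Q}(s)$, and let $E_A$ be the elliptic curve $y^2=(x+A)(x-2)(x+2)$ over $\mathbb{Q}(s)$, with $2$-torsion points $T_1=(-A,0)$, $T_2=(2,0)$, $T_3=(-2,0)$. Let $f=\frac{2y}{(x-2)(x+2)}\in\mathbb{Q}(s)(E_A)^*$, and for a torsion point $T\in E_A(\mathbb{Q}(s))_{\mathrm{tors}}$ put $$\chi_f(T)=\left[\frac{f(\cdot+T)}{f(\cdot)}\right]\in \mathbb{Q}(s)(E_A)^*/\mathbb{Q}(s)(E_A)^{*2}.$$ Then: (a) $\chi_f(T_1)=[-1]$ and $\chi_f(T_2)=[-1]$ (and these classes are non-trivial); (b) $\chi_f(T_3)=[1]$, the trivial class; (c) $\chi_f(T_4)\neq 1$ for every point $T_4\in E_A(\mathbb{Q}(s))$ of order $4$.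
   Context: $\mathbb{Q}(s)(E_A)$ denotes the function field of $E_A$ over $\mathbb{Q}(s)$. $f(\cdot+T)$ denotes the pullback of $f$ under translation $P\mapsto P+T$ in the group law, and $[g]$ denotes the class of $g$ modulo squares of nonzero elements of the function field. The symbol $1$ denotes the trivial class. *)

(* Defs.v *)
From HB Require Import structures.
From mathcomp Require Import all_boot all_order all_algebra all_field.
From mathcomp Require Import classical_sets.

Set Implicit Arguments.
Unset Strict Implicit.
Unset Printing Implicit Defensive.

Import GRing.Theory.
Local Open Scope ring_scope.

(* Points, over a field F, of y^2 = (x + A)(x - 2)(x + 2)
   = x^3 + A x^2 - 4 x - 4 A, which is an elliptic curve when F has
   characteristic different from 2 and A is neither 2 nor -2. *)
Section GroupLaw.

Variables (F : fieldType) (A : F).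

Inductive point : Type := Infty | Affine of F & F.

Definition on_curve (P : point) : Prop :=
  if P is Affine x y then y ^+ 2 = (x + A) * (x - 2) * (x + 2) else True.

(* The reflection of the third intersection point of the curve with the line of
   slope l through (x1, y1) and a point of abscissa x2. *)
Definition third_point (l x1 y1 x2 : F) : point :=
  let x3 := l ^+ 2 - A - x1 - x2 in Affine x3 (l * (x1 - x3) - y1).

(* Two points of the curve with the same abscissa and y1 + y2 != 0 coincide and
   have y1 != 0, so that the line to use is the (non vertical) tangent. *)
Definition addp (P Q : point) : point :=
  match P, Q with
  | Infty, _ => Q
  | _, Infty => P
  | Affine x1 y1, Affine x2 y2 =>
      if x1 != x2 then third_point ((y2 - y1) / (x2 - x1)) x1 y1 x2
      else if y1 + y2 == 0 then Infty
      else third_point ((3 * x1 ^+ 2 + 2 * A * x1 - 4) / (2 * y1)) x1 y1 x2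
  end.

Definition mulp (n : nat) (P : point) : point := iter n (addp P) Infty.

Definition has_order (n : nat) (P : point) : Prop :=
  [/\ (0 < n)%N, mulp n P = Infty
    & forall m : nat, (0 < m < n)%N -> mulp m P <> Infty].

End GroupLaw.

Arguments Infty {F}.

Section FunctionField.

Variables (K : fieldType) (A : K).

Definition curve_cubic : {poly K} := ('X + A%:P) * ('X - 2%:P) * ('X + 2%:P).

Definition curve_poly : {poly {fraction {poly K}}} :=
  'X^2 - (FracField.tofrac curve_cubic)%:P.

Lemma size_curve_cubic : size curve_cubic = 4%N.
Proof.
have sXD (a : K) : size ('X + a%:P) = 2%N by rewrite size_XaddC.
have nz (a : K) : 'X + a%:P != 0 by rewrite -size_poly_eq0 sXD.
have e2 : 'X - 2%:P = 'X + (- 2)%:P :> {poly K} by rewrite polyCN.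
by rewrite /curve_cubic e2 !size_mul ?mulf_neq0 ?nz // !sXD.
Qed.

Lemma frac_numden (R : idomainType) (r : {fraction R}) :
  r * FracField.tofrac \d_(repr r) = FracField.tofrac \n_(repr r).
Proof.
rewrite -[X in X * _]reprK; unlock FracField.tofrac.
rewrite -[LHS]FracField.pi_mul; apply/eqmodP.
rewrite /= /FracField.equivf /FracField.mulf /=.
by rewrite !numden_Ratio ?mulf_neq0 ?oner_eq0 ?denom_ratioP // !mulr1 mulrC.
Qed.

(* The cubic has odd degree, so it is not a square in K(x). *)
Lemma curve_poly_irreducible : monic_irreducible_poly curve_poly.
Proof.
have sz : size curve_poly = 3%N.
  by rewrite size_polyDl ?size_polyXn // size_polyN size_polyC; case: eqP.
split; last first.
  rewrite monicE /lead_coef sz /curve_poly coefB coefXn coefC /=.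
  by rewrite subr0.
apply: cubic_irreducible; first by rewrite sz.
move=> r; apply/negP => /rootP.
rewrite /curve_poly !hornerE => /eqP; rewrite subr_eq0 => /eqP rE.
set n := \n_(repr r); set d := \d_(repr r).
have d0 : d != 0 by apply: denom_ratioP.
have : FracField.tofrac (n ^+ 2) = FracField.tofrac (curve_cubic * d ^+ 2).
  by rewrite tofracXn tofracM tofracXn -rE -exprMn frac_numden.
move/eqP; rewrite tofrac_eq => /eqP nE.
have c0 : curve_cubic != 0 by rewrite -size_poly_eq0 size_curve_cubic.
have n0 : n != 0.
  apply/eqP => n0; move/eqP: nE; rewrite n0 expr0n /= eq_sym.
  by rewrite mulf_eq0 expf_eq0 (negPf c0) (negPf d0).
have szE : size (n ^+ 2) = size (curve_cubic * d ^+ 2) by rewrite nE.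
have := congr1 odd szE.
rewrite (@size_mul _ curve_cubic) ?expf_neq0 // size_curve_cubic.
rewrite !expr2 !size_mul //.
case: (size n) (size_poly_gt0 n) => [|a _]; first by rewrite n0.
case: (size d) (size_poly_gt0 d) => [|b _]; first by rewrite d0.
by rewrite !addnS !addSn /= !negbK !oddD !addbb.
Qed.

(* K(x)[y] modulo y^2 - (x + A)(x - 2)(x + 2). *)
Definition function_field : fieldType :=
  {poly %/ curve_poly with curve_poly_irreducible}.

Definition ff_const (k : K) : function_field :=
  qpolyC curve_poly (FracField.tofrac k%:P).
Definition ff_x : function_field := qpolyC curve_poly (FracField.tofrac 'X).
Definition ff_y : function_field := in_qpoly curve_poly 'X.

(* The value at u of a rational function over K; it does not depend on the
   chosen representative num / den as soon as u is transcendental over K. *)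
Definition eval_frac (u : function_field) (r : {fraction {poly K}}) :
    function_field :=
  (map_poly ff_const \n_(repr r)).[u] / (map_poly ff_const \d_(repr r)).[u].

(* The value at (u, v) of h = a(x) + b(x) y, namely a(u) + b(u) v. *)
Definition eval_fun (u v : function_field) (h : function_field) :
    function_field :=
  (map_poly (eval_frac u) (polyn (h : {poly %/ curve_poly}))).[v].

Definition const_point (T : point K) : point function_field :=
  if T is Affine a b then Affine (ff_const a) (ff_const b) else Infty.

(* The pullback h( . + T): as an element of the function field, it is the value
   of h at (x, y) + T, where (x, y) is the generic point of the curve.  For T
   on the curve, (x, y) + T is an affine point, with an abscissa which is
   transcendental over K. *)
Definition translate (T : point K) (h : function_field) : function_field :=
  if addp (ff_const A) (Affine ff_x ff_y) (const_point T) is Affine u v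
  then eval_fun u v h else 0.

End FunctionField.

(* The class of g modulo nonzero squares, i.e. the coset g L^*2. *)
Definition sqclass (L : fieldType) (g : L) : set L :=
  [set h | exists2 u : L, u != 0 & h = g * u ^+ 2]%classic.

Definition chi (K : fieldType) (A : K) (f : function_field A) (T : point K) :
    set (function_field A) :=
  sqclass (translate T f / f).

Definition Qs : fieldType := {fraction {poly rat}}.

Definition s : Qs := FracField.tofrac 'X.

Definition c : Qs := (s ^+ 4 - 6 * s ^+ 2 + 1) / (1 + s ^+ 2) ^+ 2.

Definition A : Qs := 2 - 4 * c ^+ 2.

Definition f : function_field A :=
  2 * ff_y A / ((ff_x A - 2) * (ff_x A + 2)).

Definition T1 : point Qs := Affine (- A) 0.
Definition T2 : point Qs := Affine 2 0.
Definition T3 : point Qs := Affine (- 2) 0.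

(* Main.v *)
(* Translation by a 2-torsion point is explicit: f(P + T_1) = - f(P), and
   f(P + T_2), f(P + T_3) are -1, resp. 1, times f(P) (y / (2 (x + A)))^2.  For
   T = (a, b) with b != 0, f(. + T) takes the nonzero value f(T) at the point at
   infinity, whereas f has a simple zero there; so their quotient has odd order
   and is not a square.  Points of order 4 have b != 0.  Evaluating functions at
   (x, y) + T makes sense because its abscissa u takes the value a at infinity
   without being the constant a, hence is transcendental. *)
From HB Require Import structures.
Require Import Defs.
From mathcomp Require Import all_boot all_order all_algebra all_field.
From mathcomp Require Import zify ring.
From mathcomp Require classical_sets.
Set Implicit Arguments.
Unset Strict Implicit.
Unset Printing Implicit Defensive.
Import GRing.Theory.
Local Open Scope ring_scope.

(** * Polynomials: top coefficients, parity of degrees, sums of two squares *)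

Lemma coefM_top (R : nzRingType) (p q : {poly R}) k l :
  (size p <= k.+1)%N -> (size q <= l.+1)%N ->
  (p * q)`_(k + l) = p`_k * q`_l.
Proof.
move=> sp sq; rewrite coefM.
have kl : (k < (k + l).+1)%N by rewrite ltnS leq_addr.
rewrite (bigD1 (Ordinal kl)) //= addKn big1 ?addr0 // => i.
rewrite -val_eqE /= neq_ltn => /orP[ik|ki].
  by rewrite [q`__]nth_default ?mulr0 // (leq_trans sq) // ltn_subRL ltn_add2r.
by rewrite nth_default ?mul0r // (leq_trans sp).
Qed.

(** A nonzero square has even degree, so multiplying by it preserves the parity of the size. *)
Lemma odd_sizeM_sqr (R : idomainType) (p q r t : {poly R}) :
  p != 0 -> q != 0 -> r != 0 -> p * q ^+ 2 = r * t ^+ 2 ->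
  odd (size p) = odd (size r).
Proof.
move=> p0 q0 r0 e.
have t0 : t != 0.
  apply: contra_eq_neq e => ->.
  by rewrite expr0n mulr0 mulf_neq0 ?expf_neq0.
have odd_size (h g : {poly R}) : h != 0 -> g != 0 ->
    odd (size (h * g ^+ 2)) = odd (size h).
  move=> h0 g0; rewrite expr2 !size_mul ?mulf_neq0 //.
  case: (size g) (size_poly_gt0 g) => [|a _]; first by rewrite g0.
  by case: (size h) (size_poly_gt0 h) => [|b _]; [rewrite h0 | lia].
by rewrite -(odd_size p q) // e odd_size.
Qed.

(** From a^2 = -b^2, the squares of the leading coefficients also sum to 0. *)
Lemma poly_sum2_eq0 (R : idomainType) :
  (forall a b : R, a ^+ 2 + b ^+ 2 = 0 -> a = 0) ->
  forall a b : {poly R}, a ^+ 2 + b ^+ 2 = 0 -> a = 0.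
Proof.
move=> ani a b ab; apply/eqP; rewrite -lead_coef_eq0; apply/eqP.
apply: (ani _ (lead_coef b)); rewrite -!lead_coef_exp.
by rewrite (eqP (_ : a ^+ 2 == - b ^+ 2)) ?lead_coefN ?addNr // -addr_eq0 ab.
Qed.

(** * Quadratic extensions of K(x) and the point at infinity *)

Section QuadraticExtension.

Variables (K L : fieldType) (C : {poly K}) (phi : {rmorphism {poly K} -> L}).
Variable (y : L).

Local Notation cst a := (phi a%:P).
Local Notation x := (phi 'X).

(** These hypotheses describe L as K(x)(y) with y^2 = C a cubic, denominators being cleared so that
    only polynomials occur. *)
Hypothesis size_C : size C = 4%N.
Hypothesis y2 : y ^+ 2 = phi C.
Hypothesis free_y : forall p q, phi p + phi q * y = 0 -> p = 0 /\ q = 0.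
Hypothesis span_y : forall h : L, exists d p q : {poly K},
  d != 0 /\ phi d * h = phi p + phi q * y.

Lemma phi_eq0 p : (phi p == 0) = (p == 0).
Proof.
apply/eqP/eqP => [e|->]; last exact: rmorph0.
by case: (@free_y p 0) => //; rewrite rmorph0 mul0r addr0.
Qed.

(* h = (p + q y)/d lies in the local ring at the point at infinity, with residue
   r: there x has a pole of order 2 and y one of order 3. *)
Definition value_at_infty (h : L) (r : K) : Prop :=
  exists k (d p q : {poly K}),
  [/\ size d <= k.+1, size p <= k.+1 & size q < k]%N /\
  [/\ d`_k = 1, p`_k = r & phi d * h = phi p + phi q * y].

Lemma value_const a : value_at_infty (cst a) a.
Proof.
(* The strict bound [size q < k] rules out k = 0, so a is written as aX / X. *)
exists 1%N, 'X, (a%:P * 'X), 0; split; split; rewrite ?size_poly0 ?size_polyX //.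
- by rewrite (leq_trans (size_polyMleq _ _)) // size_polyX size_polyC; case: eqP.
- by rewrite coefX.
- by rewrite coefCM coefX mulr1.
- by rewrite rmorph0 mul0r addr0 -rmorphM mulrC.
Qed.

Lemma valueD g h r t : value_at_infty g r -> value_at_infty h t ->
  value_at_infty (g + h) (r + t).
Proof.
move=> [k [d [p [q [[sd sp sq] [d1 p1 e]]]]]].
move=> [l [d' [p' [q' [[sd' sp' sq'] [d1' p1' e']]]]]].
exists (k + l)%N, (d * d'), (p * d' + d * p'), (q * d' + d * q').
split; split.
- by have := size_polyMleq d d'; lia.
- apply: leq_trans (size_polyD _ _) _.
  by have := size_polyMleq p d'; have := size_polyMleq d p'; lia.
- apply: leq_ltn_trans (size_polyD _ _) _.
  by have := size_polyMleq q d'; have := size_polyMleq d q'; lia.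
- by rewrite coefM_top // d1 d1' mulr1.
- by rewrite coefD !coefM_top // d1 d1' p1 p1' mulr1 mul1r.
- rewrite !rmorphD !rmorphM.
  transitivity (phi d' * (phi d * g) + phi d * (phi d' * h)); first by ring.
  by rewrite e e'; ring.
Qed.

Lemma valueM g h r t : value_at_infty g r -> value_at_infty h t ->
  value_at_infty (g * h) (r * t).
Proof.
move=> [k [d [p [q [[sd sp sq] [d1 p1 e]]]]]].
move=> [l [d' [p' [q' [[sd' sp' sq'] [d1' p1' e']]]]]].
(* The term brought in by y^2 = C has degree at most (k - 2) + (l - 2) + 3, below k + l, so it does
   not affect the residue. *)
have sqqC : (size (q * q' * C)%R <= k + l)%N.
  have [->|q0] := eqVneq q 0; first by rewrite !mul0r size_poly0.
  have [->|q'0] := eqVneq q' 0; first by rewrite mulr0 mul0r size_poly0.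
  have C0 : C != 0 by rewrite -size_poly_eq0 size_C.
  rewrite (size_mul (mulf_neq0 q0 q'0) C0) (size_mul q0 q'0) size_C.
  move: q0 q'0 sq sq'; rewrite -!size_poly_gt0.
  by move: (size q) (size q') => a b; lia.
exists (k + l)%N, (d * d'), (p * p' + q * q' * C), (p * q' + q * p').
split; split.
- by have := size_polyMleq d d'; lia.
- apply: leq_trans (size_polyD _ _) _.
  by have := size_polyMleq p p'; lia.
- apply: leq_ltn_trans (size_polyD _ _) _.
  by have := size_polyMleq p q'; have := size_polyMleq q p'; lia.
- by rewrite coefM_top // d1 d1' mulr1.
- by rewrite coefD coefM_top // p1 p1' [X in _ + X]nth_default ?addr0.
- rewrite !rmorphD !rmorphM.
  transitivity ((phi d * g) * (phi d' * h)); first by ring.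
  by rewrite e e' -y2; ring.
Qed.

(** Used contrapositively: an element with a nonzero value at infinity is nonzero. *)
Lemma value0_eq r : value_at_infty 0 r -> r = 0.
Proof.
move=> [k [d [p [q [_ [_ <-]]]]]]; rewrite mulr0 => /esym/free_y[-> _].
by rewrite coef0.
Qed.

(** For the function field this is, up to conversion, the numerator and the denominator in
    [eval_frac]. *)
Definition value_poly (p : {poly K}) (u : L) : L :=
  (map_poly (fun a => cst a) p).[u].

Lemma value_polyMXaddC p a u :
  value_poly (p * 'X + a%:P) u = value_poly p u * u + cst a.
Proof.
rewrite /value_poly.
(* As a composite, the coefficient map is recognised as a ring morphism. *)
have -> : map_poly (fun a => cst a) =1 map_poly (phi \o polyC) by [].
by rewrite rmorphD rmorphM /= map_polyX map_polyC hornerMXaddC.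
Qed.

Lemma value_polyM p q u : value_poly (p * q) u = value_poly p u * value_poly q u.
Proof.
rewrite /value_poly.
have -> : map_poly (fun a => cst a) =1 map_poly (phi \o polyC) by [].
by rewrite rmorphM hornerM.
Qed.

Lemma value_polyXsubC a u : value_poly ('X - a%:P) u = u - cst a.
Proof.
have -> : 'X - a%:P = (0 * 'X + 1%:P) * 'X + (- a)%:P by rewrite polyCN; ring.
rewrite !value_polyMXaddC /value_poly map_poly0 horner0 polyCN rmorphN.
by rewrite !rmorph1; ring.
Qed.

Lemma value_poly0 u : value_poly 0 u = 0.
Proof. by rewrite /value_poly map_poly0 horner0. Qed.

Lemma value_value_poly u a p : value_at_infty u a ->
  value_at_infty (value_poly p u) p.[a].
Proof.
move=> ua; elim/poly_ind: p => [|p b IH].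
  by rewrite value_poly0 horner0 -(rmorph0 phi); apply: value_const.
rewrite value_polyMXaddC hornerMXaddC.
by apply: valueD (value_const _); apply: valueM.
Qed.

(* Writing p = (X - a)^m q with q(a) <> 0, q(u) takes the value q(a) <> 0 at
   infinity, while u - a <> 0. *)
Lemma value_poly_neq0 u a p : value_at_infty u a -> u != cst a -> p != 0 ->
  value_poly p u != 0.
Proof.
move=> ua nua p0.
have [m [q /implyP/(_ p0) qa ->]] := multiplicity_XsubC p a.
rewrite value_polyM mulf_neq0 //.
  apply/eqP => qu0; have := value_value_poly q ua; rewrite qu0.
  by move/value0_eq => q0; rewrite /root q0 eqxx in qa.
elim: m => [|m IH].
  rewrite expr0 (_ : 1 = 0 * 'X + 1%:P); last by rewrite mul0r add0r.
  by rewrite value_polyMXaddC value_poly0 mul0r add0r rmorph1 oner_eq0.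
by rewrite exprS value_polyM mulf_neq0 // value_polyXsubC subr_eq0.
Qed.

(** If u = (p + q y)/d, then u^2 = -1 gives p^2 + q^2 C + d^2 = 0 and 2 p q = 0. For p = 0, C q^2 =
    -d^2 contradicts the odd degree of C; for q = 0, d^2 + p^2 = 0 forces d = 0. *)
Lemma neg1_not_sqr :
  (forall a b : K, a ^+ 2 + b ^+ 2 = 0 -> a = 0) -> 2%:R != 0 :> K ->
  forall u : L, u ^+ 2 <> -1.
Proof.
move=> ani two0 u u2; have [d [p [q [d0 e]]]] := span_y u.
have : phi (p ^+ 2 + q ^+ 2 * C + d ^+ 2) + phi (2%:R * p * q) * y = 0.
  rewrite !(rmorphD, rmorphM, rmorphXn, rmorph_nat) -y2.
  transitivity ((phi p + phi q * y) ^+ 2 + phi d ^+ 2); first by ring.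
  by rewrite -e exprMn u2; ring.
move/free_y => [e1 /eqP]; rewrite !mulf_eq0 -polyC_natr polyC_eq0 (negPf two0).
case/orP=> /eqP z.
  have C0 : C != 0 by rewrite -size_poly_eq0 size_C.
  have q0 : q != 0.
    apply: contra_neq d0 => q0; apply: (poly_sum2_eq0 ani (b := 0)).
    by rewrite -[RHS]e1 z q0; ring.
  have : C * q ^+ 2 = (-1)%:P * d ^+ 2.
    by apply/eqP; rewrite -subr_eq0 -e1 z polyCN; apply/eqP; ring.
  move/odd_sizeM_sqr => /(_ C0 q0); rewrite size_C size_polyC.
  by rewrite polyC_eq0 oppr_eq0 oner_eq0 => /(_ isT).
case/eqP: d0; apply: (poly_sum2_eq0 ani (b := p)).
by rewrite -[RHS]e1 z; ring.
Qed.

(* Taking norms down to K(x) turns the equation into one between polynomials;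
   the norm of y is -C, of odd degree. *)
Lemma odd_order_not_sqr (w1 w2 g : L) (e : {poly K}) r t :
  value_at_infty w1 r -> value_at_infty w2 t -> r != 0 -> t != 0 -> e != 0 ->
  y * w1 * g ^+ 2 <> w2 * phi e.
Proof.
move=> [k [d [p [q [[sd sp sq] [d1 p1 E1]]]]]].
move=> [l [d' [p' [q' [[sd' sp' sq'] [d1' p1' E2]]]]]] r0 t0 e0 E.
have [f [m [n [f0 Eg]]]] := span_y g.
(* In the norm of a + b y, the part b^2 C has degree at most 2(i - 2) + 3 < 2i, so a^2 dominates. *)
have size_norm (a b : {poly K}) i : (size a <= i.+1)%N -> a`_i != 0 ->
    (size b < i)%N -> size (a ^+ 2 - b ^+ 2 * C) = (i + i).+1.
  move=> sa ai sb; have sa' : size a = i.+1.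
    by apply/eqP; rewrite eqn_leq sa ltnNge; apply: contra_neqN ai; apply: nth_default.
  have a0 : a != 0 by rewrite -size_poly_eq0 sa'.
  have sa2 : size (a ^+ 2) = (i + i).+1 by rewrite expr2 size_mul // sa' addnS.
  rewrite size_polyDl ?sa2 // size_polyN ltnS.
  have [->|b0] := eqVneq b 0; first by rewrite expr0n mul0r size_poly0.
  have C0 : C != 0 by rewrite -size_poly_eq0 size_C.
  rewrite (size_mul (expf_neq0 2 b0) C0) expr2 (size_mul b0 b0) size_C.
  by move: b0 sb; rewrite -size_poly_gt0; move: (size b) => j; lia.
(* The equation times [d * d' * f ^+ 2], with both sides expanded in the basis 1, y. *)
have : phi ((p' * e * d * f ^+ 2)) + phi (q' * e * d * f ^+ 2) * y =
  phi ((q * (m ^+ 2 + n ^+ 2 * C) + p * 2%:R * m * n) * C * d') +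
  phi ((p * (m ^+ 2 + n ^+ 2 * C) + q * 2%:R * m * n * C) * d') * y.
  rewrite !(rmorphD, rmorphM, rmorphXn, rmorph_nat) -y2.
  transitivity ((phi p' + phi q' * y) * phi e * phi d * phi f ^+ 2); first by ring.
  rewrite -E2.
  transitivity ((w2 * phi e) * (phi d' * phi d * phi f ^+ 2)); first by ring.
  rewrite -E.
  transitivity (y * (phi d * w1) * (phi f * g) ^+ 2 * phi d'); first by ring.
  by rewrite E1 Eg; ring.
set P1 := _ * f ^+ 2; set Q1 := _ * f ^+ 2; set P2 := _ * d'; set Q2 := _ * d'.
move=> /eqP; rewrite -subr_eq0 => /eqP PQ.
have [] := @free_y (P1 - P2) (Q1 - Q2).
  by rewrite -[RHS]PQ !rmorphB; ring.
move=> /eqP; rewrite subr_eq0 => /eqP P12 /eqP; rewrite subr_eq0 => /eqP Q12.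
pose N1 := p ^+ 2 - q ^+ 2 * C; pose N2 := p' ^+ 2 - q' ^+ 2 * C.
have sN1 : size N1 = (k + k).+1 by apply: size_norm; rewrite ?p1.
have sN2 : size N2 = (l + l).+1 by apply: size_norm; rewrite ?p1'.
have C0 : C != 0 by rewrite -size_poly_eq0 size_C.
have N10 : N1 != 0 by rewrite -size_poly_eq0 sN1.
have N20 : N2 != 0 by rewrite -size_poly_eq0 sN2.
have d0 : d != 0 by apply: contra_eq_neq d1 => ->; rewrite coef0 eq_sym oner_eq0.
(* Norms of both sides. Apart from squares, [N2] of degree 2l faces [N1 * C] of degree 2k + 3. *)
have : N2 * (e * d * f ^+ 2) ^+ 2 = (- (N1 * C)) * ((m ^+ 2 - n ^+ 2 * C) * d') ^+ 2.
  transitivity (P1 ^+ 2 - Q1 ^+ 2 * C); first by rewrite /P1 /Q1 /N2; ring.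
  by rewrite P12 Q12 /P2 /Q2 /N1; ring.
move/odd_sizeM_sqr => /(_ N20); rewrite !mulf_neq0 ?expf_neq0 //.
rewrite oppr_eq0 mulf_neq0 // => /(_ isT isT).
rewrite size_polyN (size_mul N10 C0) sN1 sN2 size_C addnS /=.
by rewrite !oddD !addbb.
Qed.

End QuadraticExtension.

(** * Coordinates of the generic point translated by T = (a, b) *)

Section Translate.

Variables (K L : fieldType) (A a b : K) (phi : {rmorphism {poly K} -> L}).
Variable (y : L).

Local Notation C := (curve_cubic A).
Local Notation cst a := (phi a%:P).
Local Notation x := (phi 'X).

Hypothesis y2 : y ^+ 2 = phi C.
Hypothesis free_y : forall p q, phi p + phi q * y = 0 -> p = 0 /\ q = 0.

Hypothesis onC : on_curve A (Affine a b).

(** The next three formulas follow the chord case of [addp] literally, so that [translate] reduces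
    to them. *)
Definition slope_add := (cst b - y) / (cst a - x).
Definition x_add := slope_add ^+ 2 - cst A - x - cst a.
Definition y_add := slope_add * (x - x_add) - y.

Lemma x_neq_cst c : x - cst c != 0.
Proof.
by rewrite -rmorphB (phi_eq0 free_y) -size_poly_eq0 size_XsubC.
Qed.

(* Numerators over (x - a)^2 of the part of x_add free of y, and, in slope_num,
   of the same part of a - x_add. *)
Definition x_add_num : {poly K} := Poly
  [:: b ^+ 2 - 4 * A - (A + a) * a ^+ 2; a ^+ 2 + 2 * a * A - 4; a].

Lemma cst_nat n : cst n%:R = n%:R.
Proof. by rewrite polyC_natr rmorph_nat. Qed.

Lemma phi_curve : phi C = (x + cst A) * (x - 2) * (x + 2).
Proof.
rewrite -(cst_nat 2) /curve_cubic; move: (2 : K) => k.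
by rewrite !(rmorphM, rmorphB, rmorphD).
Qed.

Lemma phi_x_add_num : phi x_add_num =
  cst a * x ^+ 2 + (cst a ^+ 2 + 2 * cst a * cst A - 4) * x
  + (cst b ^+ 2 - 4 * cst A - (cst A + cst a) * cst a ^+ 2).
Proof.
rewrite -(cst_nat 2) -(cst_nat 4) /x_add_num /=.
move: (2 : K) (4 : K) => k l.
rewrite !cons_poly_def mul0r add0r !(rmorphD, rmorphN, rmorphM, rmorphXn) /=.
by ring.
Qed.

(** Multiplying out gives (y - b)^2 - (A + x + a)(x - a)^2. Once y^2 is replaced by C, the cubic
    terms cancel and x^2 keeps the coefficient A - (A + a) + 2a = a. *)
Lemma x_addE : phi (('X - a%:P) ^+ 2) * x_add =
  phi x_add_num + phi (- 2 * b)%:P * y.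
Proof.
have x0 := x_neq_cst a.
have y2' : y ^+ 2 = (x + cst A) * (x - 2) * (x + 2) by rewrite y2 phi_curve.
rewrite phi_x_add_num /x_add /slope_add rmorphXn rmorphB.
rewrite (_ : cst (- 2 * b) = - 2 * cst b); last first.
  by rewrite polyCM rmorphM polyCN rmorphN cst_nat.
move: x0 y2'; move: (phi 'X) (cst a) (cst b) (cst A) => X a' b' A' x0 y2'.
have -> : (b' - y) / (a' - X) = (y - b') / (X - a') by field; rewrite x0 -opprB oppr_eq0.
transitivity ((y - b') ^+ 2 - (A' + X + a') * (X - a') ^+ 2); first by field.
rewrite sqrrB y2'. ring.
Qed.

Lemma coef_exp_XsubC n : (('X - a%:P) ^+ n)`_n = 1.
Proof.
have /monicP := monic_exp n (monicXsubC a).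
by rewrite lead_coefE size_exp_XsubC.
Qed.

(** When the generic point goes to infinity, the origin of the group law, its translate goes to T =
    (a, b). *)
Lemma value_x_add : value_at_infty phi y x_add a.
Proof.
exists 2%N, (('X - a%:P) ^+ 2), x_add_num, (- 2 * b)%:P; split; split.
- by rewrite size_exp_XsubC.
- exact: size_Poly.
- by rewrite size_polyC; case: eqP.
- exact: coef_exp_XsubC.
- by rewrite coef_Poly.
- exact: x_addE.
Qed.

Definition slope_num : {poly K} := Poly
  [:: a ^+ 3 - (b ^+ 2 - 4 * A - (A + a) * a ^+ 2);
      - (3 * a ^+ 2 + 2 * a * A - 4)].

Lemma slope_numE : slope_num = a%:P * ('X - a%:P) ^+ 2 - x_add_num.
Proof.
rewrite /slope_num /x_add_num /= !cons_poly_def !mul0r !add0r.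
have nat_polyC n : n%:R%:P = n%:R :> {poly K} by exact: polyC_natr.
have := nat_polyC 2%N; have := nat_polyC 3%N; have := nat_polyC 4%N.
move: (2 : K) (3 : K) (4 : K) => k l m k2 l3 m4.
rewrite !(polyCD, polyCN, polyCM, polyC_exp) k2 l3 m4.
by ring.
Qed.

(** Here (x - a)^2 (x - [x_add]) = (x - a)^3 + [slope_num] + 2 b y; multiplying by y - b creates a
    y^2, replaced by C. The coefficient of x^3 in the part free of y is then 2b - b = b, the value
    at infinity. *)
Lemma y_addE : phi (('X - a%:P) ^+ 3) * y_add =
  phi ((2 * b)%:P * C - b%:P * ('X - a%:P) ^+ 3 - b%:P * slope_num) +
  phi (slope_num - (2 * b ^+ 2)%:P) * y.
Proof.
have x0 := x_neq_cst a.
have qE : phi slope_num = cst a * (x - cst a) ^+ 2 - phi x_add_num.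
  by rewrite slope_numE rmorphB rmorphM rmorphXn rmorphB.
rewrite rmorphXn !rmorphB.
rewrite (rmorphM _ (2 * b)%:P) (rmorphM _ b%:P) (rmorphM _ b%:P) rmorphXn rmorphB.
have e2 : cst (2 * b) = 2 * cst b by rewrite polyCM rmorphM cst_nat.
have -> : cst (2 * b ^+ 2) = 2 * cst b ^+ 2.
  by rewrite polyCM rmorphM polyC_exp rmorphXn cst_nat.
have uE : (x - cst a) ^+ 2 * x_add = phi x_add_num - 2 * cst b * y.
  have := x_addE; rewrite mulNr polyCN rmorphN e2 mulNr => <-.
  by rewrite rmorphXn rmorphB.
rewrite e2 -y2 /y_add /slope_add.
have -> : phi slope_num =
    cst a * (x - cst a) ^+ 2 - (x - cst a) ^+ 2 * x_add - 2 * cst b * y.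
  by rewrite uE qE; ring.
move: x0; move: x (cst a) (cst b) x_add => X a' b' u x0.
by field; rewrite -opprB oppr_eq0.
Qed.

Lemma value_y_add : value_at_infty phi y y_add b.
Proof.
exists 3%N, (('X - a%:P) ^+ 3),
  ((2 * b)%:P * C - b%:P * ('X - a%:P) ^+ 3 - b%:P * slope_num),
  (slope_num - (2 * b ^+ 2)%:P).
have sq : (size slope_num <= 2)%N by exact: size_Poly.
have sbq : (size (b%:P * slope_num)%R <= 2)%N.
  by rewrite mul_polyC; apply: leq_trans (size_scale_leq _ _) sq.
split; split.
- by rewrite size_exp_XsubC.
- rewrite mul_polyC mul_polyC.
  apply: leq_trans (size_polyD _ _) _; rewrite geq_max size_polyN (leq_trans sbq) // andbT.
  apply: leq_trans (size_polyD _ _) _; rewrite geq_max size_polyN.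
  rewrite !(leq_trans (size_scale_leq _ _)) ?size_exp_XsubC //.
  by rewrite size_curve_cubic.
- apply: leq_ltn_trans (size_polyD _ _) _; rewrite gtn_max size_polyN.
  by rewrite ltnS sq size_polyC; case: eqP.
- exact: coef_exp_XsubC.
- have C3 : C`_3 = 1.
    have -> : 3%N = (size C).-1 by rewrite size_curve_cubic.
    have /monicP : C \is monic; last by [].
    have e : 'X - 2%:P = 'X + (-2)%:P :> {poly K} by rewrite polyCN.
    have mX k : 'X + k%:P \is @monic K by rewrite monicE lead_coefXaddC.
    by rewrite /curve_cubic e !monicMr.
  have bq3 : (b%:P * slope_num)`_3 = 0 by apply: nth_default; apply: leq_trans sbq _.
  by rewrite !coefB bq3 !coefCM C3 coef_exp_XsubC; ring.
- exact: y_addE.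
Qed.

(* The linear coefficient of slope_num is - C'(a), nonzero at a root a of C on a
   smooth curve. *)
Lemma x_add_neq_cst : 2 != 0 :> K -> A != 2 ->
  A != - 2 -> x_add != cst a.
Proof.
move=> two0 A2 A2'; apply/eqP => ua.
have : phi (('X - a%:P) ^+ 2 * a%:P - x_add_num) + phi (2 * b)%:P * y = 0.
  rewrite rmorphB (rmorphM _ (_ ^+ 2)) -ua x_addE mulNr polyCN rmorphN.
  by ring.
case/free_y => e /eqP; rewrite polyC_eq0 mulf_eq0 (negPf two0) /= => /eqP b0.
move: e; rewrite mulrC -slope_numE => /(congr1 (fun p : {poly K} => p`_1)).
rewrite coef_Poly coef0 /= => /eqP; rewrite oppr_eq0 => /eqP d0.
move: onC; rewrite /= b0 expr0n /= => /esym/eqP; rewrite !mulf_eq0.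
have four0 : 4 != 0 :> K by rewrite (natrM _ 2 2) mulf_neq0.
rewrite -orbA; case/or3P=> /eqP z.
- have : (A - 2) * (A + 2) = 0.
    rewrite -[RHS]d0; have -> : a = - A by apply/eqP; rewrite -addr_eq0 z.
    by ring.
  by move/eqP; rewrite mulf_eq0 subr_eq0 addr_eq0 (negPf A2) (negPf A2').
- have : 4 * (A + 2) = 0.
    rewrite -[RHS]d0; have -> : a = 2 by apply/eqP; rewrite -subr_eq0 z.
    by ring.
  by move/eqP; rewrite mulf_eq0 (negPf four0) addr_eq0 (negPf A2').
- have : 4 * (2 - A) = 0.
    rewrite -[RHS]d0; have -> : a = -2 by apply/eqP; rewrite -addr_eq0 z.
    by ring.
  by move/eqP; rewrite mulf_eq0 (negPf four0) subr_eq0 eq_sym (negPf A2).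
Qed.

End Translate.

(** * The function field as a quadratic extension of K(x) *)

Lemma polyC_addMX_eq0 (R : nzRingType) (a b : R) :
  a%:P + b%:P * 'X = 0 -> a = 0 /\ b = 0.
Proof.
move/polyP => ab; move: (ab 0%N) (ab 1%N).
by rewrite !coefD !coefMX !coefC ?coef0 /= addr0 add0r.
Qed.

Section FunctionFieldOfCurve.

Variables (K : fieldType) (A : K).

Local Notation L := (function_field A).
Local Notation iota := (qpolyC (curve_poly A) : {fraction {poly K}} -> L).
Local Notation C := (curve_cubic A).

(** The morphism that instantiates [phi]; up to conversion, [ff_const] and [ff_x] are its values at
    constants and at 'X. *)
Definition ff_poly (p : {poly K}) : L := iota (FracField.tofrac p).

Lemma ff_poly_is_zmod_morphism : zmod_morphism ff_poly.
Proof. by move=> p q; rewrite /ff_poly rmorphB /= qpolyCD qpolyCN. Qed.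

Lemma ff_poly_is_monoid_morphism : monoid_morphism ff_poly.
Proof.
by split=> [|p q]; rewrite /ff_poly ?tofrac1 // tofracM qpolyCM.
Qed.

HB.instance Definition _ :=
  GRing.isZmodMorphism.Build {poly K} L ff_poly ff_poly_is_zmod_morphism.
HB.instance Definition _ :=
  GRing.isMonoidMorphism.Build {poly K} L ff_poly ff_poly_is_monoid_morphism.

Lemma size_curve_poly : size (curve_poly A) = 3%N.
Proof.
rewrite /curve_poly size_polyDl ?size_polyXn // size_polyN size_polyC.
by case: eqP.
Qed.

(** Quotients are taken modulo [mk_monic p], which defaults to 'X unless p is monic and
    nonconstant. *)
Lemma mk_monic_curve_poly : mk_monic (curve_poly A) = curve_poly A.
Proof.
by case: (curve_poly_irreducible A) => _ mC; rewrite /mk_monic size_curve_poly mC.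
Qed.

Lemma in_qpolyC r : in_qpoly (curve_poly A) r%:P = qpolyC (curve_poly A) r.
Proof.
apply/val_inj/in_qpoly_small; rewrite mk_monic_curve_poly size_curve_poly.
by rewrite size_polyC; case: eqP.
Qed.

Lemma in_qpolyE (a b : {fraction {poly K}}) :
  in_qpoly (curve_poly A) (a%:P + b%:P * 'X) =
  qpolyC (curve_poly A) a + qpolyC (curve_poly A) b * in_qpoly (curve_poly A) 'X.
Proof.
by rewrite in_qpolyD in_qpolyM; congr (_ + _ * _); exact: in_qpolyC.
Qed.

(** [eval_fun] reads the coefficients of the reduced representative, which is identified here. *)
Lemma val_ff (a b : {fraction {poly K}}) :
  polyn (iota a + iota b * ff_y A : {poly %/ curve_poly A}) = a%:P + b%:P * 'X.
Proof.
transitivity (polyn (in_qpoly (curve_poly A) (a%:P + b%:P * 'X))).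
  by congr polyn; symmetry; exact: in_qpolyE.
apply: in_qpoly_small; rewrite mk_monic_curve_poly size_curve_poly.
by rewrite addrC size_MXaddC; case: ifP => // _; rewrite ltnS size_polyC; case: eqP.
Qed.

Lemma ff_decomp (h : L) : exists a b, h = iota a + iota b * ff_y A.
Proof.
pose p := polyn (h : {poly %/ curve_poly A}).
exists p`_0, p`_1; apply: val_inj; apply: etrans (esym (val_ff _ _)).
apply/polyP => i; rewrite coefD coefC coefMX coefC.
have sp : (size p <= 2)%N.
  by rewrite -ltnS (leq_trans (size_mk_monic _)) // mk_monic_curve_poly size_curve_poly.
case: i => [|[|i]] /=; rewrite ?addr0 ?add0r //.
by rewrite nth_default // (leq_trans sp).
Qed.

Lemma ff_y2 : ff_y A ^+ 2 = ff_poly C.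
Proof.
have e : in_qpoly (curve_poly A) ('X * 'X) =
    qpolyC (curve_poly A) (FracField.tofrac C).
  rewrite (_ : 'X * 'X = curve_poly A + (FracField.tofrac C)%:P); last first.
    by rewrite /curve_poly subrK.
  rewrite in_qpolyD in_qpolyC (_ : in_qpoly _ (curve_poly A) = 0) ?add0r //.
  apply/val_inj; rewrite /= mk_monic_curve_poly.
  by case: (curve_poly_irreducible A) => _ /Pdiv.RingMonic.rmodpp.
by rewrite /ff_poly -e in_qpolyM.
Qed.

Lemma ff_free p q : ff_poly p + ff_poly q * ff_y A = 0 -> p = 0 /\ q = 0.
Proof.
move=> e.
have {}e : in_qpoly (curve_poly A)
    ((FracField.tofrac p)%:P + (FracField.tofrac q)%:P * 'X) =
    in_qpoly (curve_poly A) 0.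
  by rewrite in_qpolyE in_qpoly0; exact: e.
move/(congr1 (@polyn _ _)): e; rewrite in_qpolyE val_ff.
rewrite (@in_qpoly_small _ _ 0) ?size_poly0 ?size_mk_monic_gt0 //.
move/polyC_addMX_eq0 => [p0 q0].
split.
  move/eqP: p0.
  rewrite tofrac_eq0.
  by move/eqP.
move/eqP: q0.
rewrite tofrac_eq0.
by move/eqP.
Qed.

Lemma ff_span (h : L) : exists d p q : {poly K},
  d != 0 /\ ff_poly d * h = ff_poly p + ff_poly q * ff_y A.
Proof.
have [a [b ->]] := ff_decomp h.
exists (\d_(repr a) * \d_(repr b)), (\n_(repr a) * \d_(repr b)).
exists (\n_(repr b) * \d_(repr a)); split.
  by rewrite mulf_neq0 ?denom_ratioP.
rewrite !rmorphM /= /ff_poly -!frac_numden !qpolyCM.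
have clear_denoms (R : comNzRingType) (u v w z t : R) :
  u * v * (w + z * t) = w * u * v + z * v * u * t by ring.
exact: clear_denoms.
Qed.

End FunctionFieldOfCurve.

(** * Pullback of f under translation *)

Section EvaluationAtTranslate.

Variables (K : fieldType) (A a b : K).

Local Notation L := (function_field A).
Local Notation ffp := (@ff_poly K A).
Local Notation y := (ff_y A).

(** The function [f], over an arbitrary field K and for any parameter A. *)
Definition double_y_quotient : L := 2 * y / ((ff_x A - 2) * (ff_x A + 2)).

(** Any representative p/e may replace the chosen one: by cross-multiplication, since no nonzero
    polynomial vanishes at u. *)
Lemma eval_frac_quotient (u : L) (p e : {poly K}) :
  value_at_infty ffp y u a -> u != ff_const A a -> e != 0 ->
  eval_frac u (FracField.tofrac p / FracField.tofrac e) =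
  value_poly ffp p u / value_poly ffp e u.
Proof.
move=> ua nua e0; rewrite /eval_frac; set r := FracField.tofrac p / _.
have d0 : \d_(repr r) != 0 by apply: denom_ratioP.
have := frac_numden r; rewrite {1}/r.
move: (\n_(repr r)) (\d_(repr r)) d0 => n d d0 nd.
have {}nd : p * d = n * e.
  apply/eqP; rewrite -tofrac_eq !tofracM -nd mulrAC divfK ?tofrac_eq0 //.
have vd := value_poly_neq0 (size_curve_cubic A) (@ff_y2 K A) (@ff_free K A) ua nua.
apply/eqP; rewrite (eqr_div _ _ (vd _ d0) (vd _ e0)).
by rewrite -/(value_poly ffp n u) -(value_polyM ffp) -nd value_polyM.
Qed.

Local Notation E := (('X - 2%:P) * ('X + 2%:P) : {poly K}).

Lemma ff_nat n : ff_const A n%:R = n%:R.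
Proof. exact: (cst_nat ffp). Qed.

Lemma E_neq0 : E != 0.
Proof.
by rewrite mulf_neq0 // -?polyCN -size_poly_eq0 ?size_XsubC ?size_XaddC.
Qed.

Lemma ff_polyE : ff_poly A E = (ff_x A - 2) * (ff_x A + 2).
Proof.
rewrite -(ff_nat 2); move: (2 : K) => k.
by rewrite rmorphM rmorphB rmorphD.
Qed.

Lemma value_polyE u : value_poly ffp E u = (u - 2) * (u + 2).
Proof.
rewrite value_polyM value_polyXsubC (_ : 'X + 2%:P = 'X - (- 2)%:P); last first.
  by rewrite polyCN opprK.
by rewrite value_polyXsubC polyCN rmorphN opprK (cst_nat ffp).
Qed.

Lemma double_y_quotientE : double_y_quotient =
  qpolyC (curve_poly A) (FracField.tofrac 2%:P / FracField.tofrac E) * y.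
Proof.
have E0 : ff_poly A E != 0 by rewrite (phi_eq0 (@ff_free K A)) E_neq0.
rewrite /double_y_quotient -ff_polyE.
apply: (canLR (mulfK E0)).
have -> : qpolyC (curve_poly A) (FracField.tofrac 2%:P / FracField.tofrac E)
    * y * ff_poly A E = qpolyC (curve_poly A)
      (FracField.tofrac 2%:P / FracField.tofrac E * FracField.tofrac E) * y.
  by rewrite mulrAC; congr (_ * _); symmetry; exact: qpolyCM.
by rewrite divfK ?tofrac_eq0 ?E_neq0 // -[qpolyC _ _]/(ff_const A 2) ff_nat.
Qed.

Lemma eval_double_y_quotient u v :
  value_at_infty ffp y u a -> u != ff_const A a ->
  eval_fun u v double_y_quotient = 2 * v / ((u - 2) * (u + 2)).
Proof.
move=> ua nua; rewrite /eval_fun.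
have -> : polyn (double_y_quotient : {poly %/ curve_poly A}) =
    (FracField.tofrac 2%:P / FracField.tofrac E)%:P * 'X.
  have := val_ff A 0 (FracField.tofrac 2%:P / FracField.tofrac E).
  by rewrite -double_y_quotientE qpolyC0 !add0r.
(* [eval_frac u] carries no morphism structure; fixing 0 is what makes [map_poly] act
   coefficientwise. *)
have ev0 : eval_frac u 0 = 0.
  rewrite -(mul0r (FracField.tofrac 1)^-1) -(tofrac0 {poly K}).
  by rewrite eval_frac_quotient ?oner_eq0 // value_poly0 mul0r.
have -> : map_poly (eval_frac u)
    ((FracField.tofrac 2%:P / FracField.tofrac E)%:P * 'X) =
    (eval_frac u (FracField.tofrac 2%:P / FracField.tofrac E))%:P * 'X.
  apply/polyP => i; rewrite coef_map_id0 // !coefMX !coefC.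
  by case: i => [|[|i]].
rewrite hornerMX hornerC (eval_frac_quotient _ ua nua E_neq0) value_polyE.
rewrite (_ : value_poly ffp 2%:P u = 2) 1?mulrAC //.
rewrite (_ : 2%:P = 0 * 'X + 2%:P); last by rewrite mul0r add0r.
by rewrite value_polyMXaddC value_poly0 mul0r add0r -[RHS]ff_nat.
Qed.

Local Notation X := (x_add A a b ffp y).
Local Notation Y := (y_add A a b ffp y).

Lemma translate_double_y_quotient :
  on_curve A (Affine a b) -> 2 != 0 :> K -> A != 2 -> A != - 2 ->
  translate (Affine a b) double_y_quotient = 2 * Y / ((X - 2) * (X + 2)).
Proof.
move=> onC two0 A2 A2'; rewrite /translate /addp /const_point.
(* The generic abscissa is not constant, so [addp] takes its chord branch. *)
have := x_neq_cst (@ff_free K A) a; rewrite subr_eq0 => xa.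
rewrite (_ : ff_x A != ff_const A a) //.
apply: eval_double_y_quotient.
  exact: value_x_add (@ff_y2 K A) (@ff_free K A).
exact: (x_add_neq_cst (@ff_y2 K A) (@ff_free K A) onC two0 A2 A2').
Qed.

(** The value at infinity is 0 when a is 2 or -2, so the argument is that a nonzero polynomial does
    not vanish at the transcendental X. *)
Lemma translate_abscissa_neq :
  on_curve A (Affine a b) -> 2 != 0 :> K -> A != 2 -> A != - 2 ->
  (X - 2) * (X + 2) != 0.
Proof.
move=> onC two0 A2 A2'; rewrite -value_polyE.
apply: (value_poly_neq0 (size_curve_cubic A) (@ff_y2 K A) (@ff_free K A)
  (value_x_add _ _ (@ff_y2 K A) (@ff_free K A))) E_neq0.
exact: (x_add_neq_cst (@ff_y2 K A) (@ff_free K A) onC two0 A2 A2').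
Qed.

End EvaluationAtTranslate.

(** * Explicit translation by the 2-torsion points *)

Section TwoTorsion.

Variables (F : fieldType) (x y A : F).

Hypothesis y2 : y ^+ 2 = (x + A) * (x - 2) * (x + 2).
Hypotheses (two0 : 2 != 0 :> F) (y0 : y != 0).

Let factors_neq0 : [/\ x + A != 0, x - 2 != 0 & x + 2 != 0].
Proof.
have : y ^+ 2 != 0 by rewrite expf_neq0.
by rewrite y2 !mulf_eq0 !negb_or => /andP[/andP[-> ->] ->].
Qed.

Local Notation slope e := ((0 - y) / (e - x)).
Local Notation abscissa e := (slope e ^+ 2 - A - x - e).
Local Notation ordinate e := (slope e * (x - abscissa e) - y).
Local Notation quotient u v := (2 * v / ((u - 2) * (u + 2))).

(** Translation by T_1 exchanges x - 2 and x + 2 up to factors. Both (u - 2)(u + 2) and v acquire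
    (A^2 - 4)/(x + A)^2, with opposite signs. *)
Lemma quotient_add_T1 :
  let u := abscissa (- A) in let v := ordinate (- A) in
  (u - 2) * (u + 2) != 0 -> quotient u v / quotient x y = - 1.
Proof.
have [h1 h2 h3] := factors_neq0.
have h1' : - A - x != 0 by rewrite -opprD oppr_eq0 addrC.
move=> u v.
have u2 : u - 2 = (- A - 2) * (x + 2) / (x + A).
  by rewrite /u expr_div_n sub0r sqrrN y2; field; rewrite h1 h1'.
have u2' : u + 2 = (2 - A) * (x - 2) / (x + A).
  by rewrite /u expr_div_n sub0r sqrrN y2; field; rewrite h1 h1'.
have vE : v = - y * (- A - 2) * (2 - A) / (x + A) ^+ 2.
  have uE : u = (- A - 2) * (x + 2) / (x + A) + 2 by rewrite -u2 subrK.
  by rewrite /v -/u uE; field; rewrite h1 h1'.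
(* The hypothesis on u now yields that A + 2 and 2 - A are nonzero, as [field] requires. *)
rewrite u2 u2' vE !mulf_eq0 !invr_eq0 !negb_or.
case/andP=> /andP[/andP[a1 _] _] /andP[/andP[a2 _] _].
by field; rewrite y0 two0 h1 h2 h3 a1 a2.
Qed.

(** The quotient simplifies to -(x - 2)(x + 2)/(4(x + A)), and (x - 2)(x + 2) = y^2/(x + A). For T_3
    only the sign of v relative to (u - 2)(u + 2) changes. *)
Lemma quotient_add_T2 :
  let u := abscissa 2 in let v := ordinate 2 in
  (u - 2) * (u + 2) != 0 ->
  quotient u v / quotient x y = - 1 * (y / (2 * (x + A))) ^+ 2.
Proof.
have [h1 h2 h3] := factors_neq0.
have h2' : 2 - x != 0 by rewrite -opprB oppr_eq0.
move=> u v.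
have u2 : u - 2 = 4 * (A + 2) / (x - 2).
  by rewrite /u expr_div_n sub0r sqrrN y2; field; rewrite h2 h2'.
have u2' : u + 2 = 4 * (x + A) / (x - 2).
  by rewrite /u expr_div_n sub0r sqrrN y2; field; rewrite h2 h2'.
have vE : v = - 4 * y * (A + 2) / (x - 2) ^+ 2.
  have uE : u = 4 * (A + 2) / (x - 2) + 2 by rewrite -u2 subrK.
  by rewrite /v -/u uE; field; rewrite h2 h2'.
rewrite u2 u2' vE !mulf_eq0 !invr_eq0 !negb_or.
case/andP=> /andP[/andP[a1 a2] _] _.
rewrite !expr_div_n y2.
by field; rewrite y0 two0 h1 h2 h3 a1 a2.
Qed.

Lemma quotient_add_T3 :
  let u := abscissa (- 2) in let v := ordinate (- 2) in
  (u - 2) * (u + 2) != 0 ->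
  quotient u v / quotient x y = 1 * (y / (2 * (x + A))) ^+ 2.
Proof.
have [h1 h2 h3] := factors_neq0.
have h3' : - 2 - x != 0 by rewrite -opprD oppr_eq0 addrC.
move=> u v.
have u2 : u - 2 = - 4 * (x + A) / (x + 2).
  by rewrite /u expr_div_n sub0r sqrrN y2; field; rewrite h3 h3'.
have u2' : u + 2 = - 4 * (A - 2) / (x + 2).
  by rewrite /u expr_div_n sub0r sqrrN y2; field; rewrite h3 h3'.
have vE : v = 4 * y * (A - 2) / (x + 2) ^+ 2.
  have uE : u = - 4 * (x + A) / (x + 2) + 2 by rewrite -u2 subrK.
  by rewrite /v -/u uE; field; rewrite h3 h3'.
rewrite u2 u2' vE !mulf_eq0 !invr_eq0 !negb_or.
case/andP=> /andP[/andP[a1 _] _] /andP[/andP[_ a2] _].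
rewrite !expr_div_n y2.
by field; rewrite y0 two0 h1 h2 h3 a1 a2.
Qed.

End TwoTorsion.

(** * Square classes and the values of chi *)

Lemma sqclassM_sqr (L : fieldType) (g w : L) :
  w != 0 -> sqclass (g * w ^+ 2) = sqclass g.
Proof.
move=> w0; rewrite /sqclass; apply/classical_sets.seteqP; split=> h [u u0 ->] /=.
  by exists (w * u); rewrite ?mulf_neq0 // -mulrA -exprMn.
exists (u / w); first by rewrite mulf_neq0 ?invr_eq0.
by rewrite -mulrA -exprMn [w * _]mulrC divfK.
Qed.

Lemma sqclass_eq1 (L : fieldType) (g : L) :
  sqclass g = sqclass 1 -> exists u, g = u ^+ 2.
Proof.
move=> e; have : sqclass g g by exists 1; rewrite ?oner_neq0 // expr1n mulr1.
by rewrite e => -[u _ ->]; exists u; rewrite mul1r.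
Qed.

(** Brings the relation to the shape excluded by [odd_order_not_sqr], where d and v are units at
    infinity and e is a polynomial in x. *)
Lemma quotient_eq_sqr (F : fieldType) (y v d e g : F) :
  2 != 0 :> F -> d != 0 -> e != 0 -> y != 0 ->
  2 * v / d / (2 * y / e) = g ^+ 2 -> y * d * g ^+ 2 = v * e.
Proof. by move=> two0 d0 e0 y0 <-; field; rewrite two0 d0 e0 y0. Qed.

Section Characters.

Variables (K : fieldType) (A : K).

Local Notation y := (ff_y A).
Local Notation x := (ff_x A).
Local Notation fxy := (double_y_quotient A).
Local Notation ffp := (@ff_poly K A).

Hypotheses (two0 : 2 != 0 :> K) (A2 : A != 2) (A2' : A != - 2).

Lemma ff_y_neq0 : y != 0.
Proof.
apply/eqP => y0; have [] := @ff_free K A 0 1.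
  by rewrite y0 mulr0 addr0 rmorph0.
by move=> _ /eqP; rewrite oner_eq0.
Qed.

Lemma ff_curve : y ^+ 2 = (x + ff_const A A) * (x - 2) * (x + 2).
Proof. by rewrite ff_y2; exact: phi_curve. Qed.

Lemma ff_two_neq0 : 2 != 0 :> function_field A.
Proof. by rewrite -(ff_nat A 2) (phi_eq0 (@ff_free K A)) polyC_eq0. Qed.

Let factors_neq0 : x + ff_const A A != 0 /\ (x - 2) * (x + 2) != 0.
Proof.
have : y ^+ 2 != 0 by rewrite expf_neq0 // ff_y_neq0.
by rewrite ff_curve -mulrA mulf_eq0 negb_or => /andP[].
Qed.

Let w_neq0 : y / (2 * (x + ff_const A A)) != 0.
Proof.
have [h _] := factors_neq0.
apply: mulf_neq0 ff_y_neq0 _.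
by rewrite invr_eq0; exact: mulf_neq0 ff_two_neq0 h.
Qed.

Lemma chi_T1 : chi fxy (Affine (- A) 0) = sqclass (- 1).
Proof.
have onC : on_curve A (Affine (- A) 0) by rewrite /= addNr !mul0r expr0n.
rewrite /chi (translate_double_y_quotient onC) //.
have := translate_abscissa_neq onC two0 A2 A2'.
rewrite /y_add /x_add /slope_add polyCN rmorphN rmorph0.
move/(quotient_add_T1 ff_curve ff_two_neq0 ff_y_neq0) => e.
by congr sqclass; exact: e.
Qed.

Lemma chi_T2 : chi fxy (Affine 2 0) = sqclass (- 1).
Proof.
have onC : on_curve A (Affine 2 0) by rewrite /= subrr mulr0 mul0r expr0n.
rewrite /chi (translate_double_y_quotient onC) //.
have := translate_abscissa_neq onC two0 A2 A2'.
rewrite /y_add /x_add /slope_add rmorph0 (cst_nat ffp).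
move/(quotient_add_T2 ff_curve ff_two_neq0 ff_y_neq0) => e.
rewrite -(sqclassM_sqr (- 1) w_neq0).
by congr sqclass; exact: e.
Qed.

Lemma chi_T3 : chi fxy (Affine (- 2) 0) = sqclass 1.
Proof.
have onC : on_curve A (Affine (- 2) 0) by rewrite /= addNr mulr0 expr0n.
rewrite /chi (translate_double_y_quotient onC) //.
have := translate_abscissa_neq onC two0 A2 A2'.
rewrite /y_add /x_add /slope_add polyCN rmorphN rmorph0 (cst_nat ffp).
move/(quotient_add_T3 ff_curve ff_two_neq0 ff_y_neq0) => e.
rewrite -(sqclassM_sqr 1 w_neq0).
by congr sqclass; exact: e.
Qed.

(* f(. + T) is a unit at the point at infinity when b <> 0, while f has a simple
   zero there. *)
Lemma chi_neq1 a b : on_curve A (Affine a b) -> b != 0 ->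
  chi fxy (Affine a b) <> sqclass 1.
Proof.
move=> onC b0.
rewrite /chi (translate_double_y_quotient onC) //.
have uE := translate_abscissa_neq onC two0 A2 A2'.
have va := value_x_add a b (@ff_y2 K A) (@ff_free K A).
have vb := value_y_add a b (@ff_y2 K A) (@ff_free K A).
have ve := value_value_poly (size_curve_cubic A) (@ff_y2 K A)
  (('X - 2%:P) * ('X + 2%:P)) va.
rewrite value_polyE in ve.
(* (a - 2)(a + 2) is a factor of b^2, which is nonzero. *)
have a0 : (('X - 2%:P) * ('X + 2%:P)).[a] != 0.
  rewrite hornerM hornerXsubC hornerD hornerX hornerC.
  apply: contraNneq b0 => z.
  have : b ^+ 2 == 0 by rewrite onC -mulrA z mulr0.
  by rewrite expf_eq0.
case/sqclass_eq1 => g /(quotient_eq_sqr ff_two_neq0 uE (proj2 factors_neq0) ff_y_neq0).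
rewrite -ff_polyE.
exact: (odd_order_not_sqr (size_curve_cubic A) (@ff_y2 K A) (@ff_free K A)
  (@ff_span K A) ve vb a0 b0 (E_neq0 K)).
Qed.

End Characters.

(** * Arithmetic of Q(s) and of the parameter A *)

Lemma frac_sum2_eq0 (R : idomainType) :
  (forall a b : R, a ^+ 2 + b ^+ 2 = 0 -> a = 0) ->
  forall a b : {fraction R}, a ^+ 2 + b ^+ 2 = 0 -> a = 0.
Proof.
move=> ani a b ab; set d := \d_(repr a); set e := \d_(repr b).
have d0 : FracField.tofrac d != 0 by rewrite tofrac_eq0 denom_ratioP.
have e0 : FracField.tofrac e != 0 by rewrite tofrac_eq0 denom_ratioP.
have : \n_(repr a) * e = 0.
  apply: (ani _ (\n_(repr b) * d)); apply/eqP; rewrite -tofrac_eq0.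
  rewrite tofracD !tofracXn !tofracM -!frac_numden -/d -/e.
  have sum_sqr (F : comNzRingType) (u v w z : F) :
    (u * w * z) ^+ 2 + (v * z * w) ^+ 2 = (u ^+ 2 + v ^+ 2) * (w * z) ^+ 2 by ring.
  by rewrite sum_sqr ab mul0r.
move/eqP; rewrite -tofrac_eq0 tofracM -frac_numden -/d !mulf_eq0.
by rewrite (negPf d0) (negPf e0) !orbF => /eqP.
Qed.

(** The property passes from the ordered field Q to Q[s] by leading coefficients, then to Q(s) by
    clearing denominators. *)
Lemma Qs_sum2_eq0 (a b : Qs) : a ^+ 2 + b ^+ 2 = 0 -> a = 0.
Proof.
apply: frac_sum2_eq0 => {}a {}b; apply: poly_sum2_eq0 => {}a {}b.
move=> /eqP; rewrite Num.Theory.paddr_eq0 ?Num.Theory.sqr_ge0 // sqrf_eq0.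
by case/andP=> /eqP.
Qed.

Lemma Qs_nat_neq0 n : n.+1%:R != 0 :> Qs.
Proof.
rewrite -tofrac1 -tofracMn tofrac_eq0 -polyC_natr polyC_eq0.
by rewrite Num.Theory.pnatr_eq0.
Qed.

Definition c_num : {poly rat} := 'X^4 - 6 * 'X^2 + 1.
Definition c_den : {poly rat} := (1 + 'X^2) ^+ 2.

Lemma cE : c = FracField.tofrac c_num / FracField.tofrac c_den.
Proof.
rewrite /c_num /c_den tofracD tofracB !tofracXn tofracM.
rewrite (rmorph_nat (@FracField.tofrac {poly rat}) 6) !tofracXn.
by rewrite [FracField.tofrac (1 + _)]tofracD tofracXn tofrac1.
Qed.

(** The point 2 suits every polynomial needed: [c_num], [c_den], their sum and [c_den - c_num] take
    the values -7, 25, 18 and 32. *)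
Lemma poly_neq0_at2 (p : {poly rat}) : p.[2] != 0 -> p != 0.
Proof. by apply: contraNneq => ->; rewrite horner0. Qed.

Lemma c_den_neq0 : FracField.tofrac c_den != 0.
Proof. by rewrite tofrac_eq0 poly_neq0_at2 // /c_den !hornerE. Qed.

(** With c = n/d, A - 2 = -4c^2 and A + 2 = 4(1 - c^2). *)
Lemma two_sub_sqr_neq (F : fieldType) (n d : F) :
  4 != 0 :> F -> n != 0 -> d != 0 -> d ^+ 2 - n ^+ 2 != 0 ->
  2 - 4 * (n / d) ^+ 2 != 2 /\ 2 - 4 * (n / d) ^+ 2 != - 2.
Proof.
move=> four0 n0 d0 dn0; split; rewrite -subr_eq0.
  have -> : 2 - 4 * (n / d) ^+ 2 - 2 = - (4 * (n / d) ^+ 2) by ring.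
  by rewrite oppr_eq0 !mulf_neq0 ?invr_eq0.
have -> : 2 - 4 * (n / d) ^+ 2 - - 2 = 4 * (d ^+ 2 - n ^+ 2) / d ^+ 2 by field.
by rewrite !mulf_neq0 ?invr_eq0 ?expf_neq0.
Qed.

Lemma A_neq : A != 2 /\ A != - 2.
Proof.
have n0 : FracField.tofrac c_num != 0.
  by rewrite tofrac_eq0 poly_neq0_at2 // /c_num !hornerE.
have nd0 : FracField.tofrac c_den ^+ 2 - FracField.tofrac c_num ^+ 2 != 0.
  rewrite subr_sqr -tofracB -tofracD.
  apply: mulf_neq0; rewrite tofrac_eq0; apply: poly_neq0_at2.
    have -> : c_den - c_num = 8%:P * 'X^2.
      by rewrite /c_num /c_den (_ : 8%:P = 8) ?polyC_natr //; ring.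
    by rewrite !hornerE.
  by rewrite /c_num /c_den !hornerE.
rewrite /A cE; exact: two_sub_sqr_neq (Qs_nat_neq0 3%N) n0 c_den_neq0 nd0.
Qed.

(** A point with b = 0 is its own opposite, so its double is already the origin. *)
Lemma order4_ordinate_neq0 (K : fieldType) (A a b : K) :
  has_order A 4 (Affine a b) -> b != 0.
Proof.
case=> _ _ /(_ 2%N isT) h; apply/eqP => b0; apply: h.
by rewrite /mulp /= b0 eqxx addr0 eqxx.
Qed.

Theorem theorem5p4 :
  [/\ [/\ chi f T1 = sqclass (- 1),
          chi f T2 = sqclass (- 1)
        & sqclass (- 1 : function_field A) <> sqclass 1],
      chi f T3 = sqclass 1
    & forall T4 : point Qs,
        on_curve A T4 -> has_order A 4 T4 -> chi f T4 <> sqclass 1].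
Proof.
have two0 := Qs_nat_neq0 1%N.
have [A2 A2'] := A_neq.
have fE : f = double_y_quotient A by [].
rewrite fE; split; first split.
- exact: chi_T1 two0 A2 A2'.
- exact: chi_T2 two0 A2 A2'.
- move/sqclass_eq1 => [u /esym].
  exact: (neg1_not_sqr (size_curve_cubic A) (@ff_y2 _ A) (@ff_free _ A)
    (@ff_span _ A) Qs_sum2_eq0 two0).
- exact: chi_T3 two0 A2 A2'.
(* The point at infinity is excluded because its first multiple is already the origin. *)
case=> [|a b] onC ord4.
  by case: ord4 => _ _ /(_ 1%N isT); case.
exact: (chi_neq1 two0 A2 A2' onC (order4_ordinate_neq0 ord4)).
Qed.
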